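(* Let $\eta\in\Omega$ and suppose $s_k(\eta,i+1)<\infty$ for some $k\in\mathbb N$ and $i\in\mathbb Z$. Then $$\zeta_k\big(T\eta,\,i+k+o_k(\eta)\big)=\zeta_k(\eta,i),$$ where the offset $o_k(\eta)$ is $$o_k(\eta)=s_\infty(\eta,0)-s_\infty(T\eta,0)+2\sum_{y=s_\infty(\eta,0)+1}^{0}\sum_{\ell=1}^{k}\eta^{\downarrow}_\ell(y)-2\sum_{y=s_\infty(T\eta,0)+1}^{0}\sum_{\ell=1}^{k}(T\eta)^{\uparrow}_\ell(y).$$
   Context: $\mathbb N=\{1,2,\dots\}$ and $\Omega=\{\eta\in\{0,1\}^{\mathbb Z}:\lim_{x\to\infty}\frac1x\sum_{y=-x}^{0}\eta(y)<\frac12\}$ (the limit is required to exist). A site $x\in\mathbb Z$ is a record of $\eta$ if $\sum_{y=z}^{x}(2\eta(y)-1)<0$ for all $z\le x$. For $\eta\in\Omega$ the set of records is unbounded below. $(s_\infty(\eta,i))_{i\in\mathbb Z}$ enumerates the records in increasing order, $s_\infty(\eta,0)$ being the largest record $\le0$; $s_\infty(\eta,i)=\infty$ if there are fewer than $i$ records in $[1,\infty)$. Carrier with seat numbers: $(\mathcal W_k(\eta,\cdot))_{k\in\mathbb N}$, $\mathcal W_k(\eta,\cdot):\mathbb Z\to\{0,1\}$, are the unique functions with $\mathcal W_k(\eta,x)=0$ for every $k$ and every record $x$, and, for all $x\in\mathbb Z$, $\mathcal W_k(\eta,x)=\mathcal W_k(\eta,x-1)+\eta^{\uparrow}_k(x)-\eta^{\downarrow}_k(x)$,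 where $$\eta^{\uparrow}_k(x)=\eta(x)(1-\mathcal W_k(\eta,x-1))\prod_{j=1}^{k-1}\mathcal W_j(\eta,x-1),\qquad \eta^{\downarrow}_k(x)=(1-\eta(x))\mathcal W_k(\eta,x-1)\prod_{j=1}^{k-1}(1-\mathcal W_j(\eta,x-1)).$$ (That is, start empty at a far-left record and run the recursion to the right; the result does not depend on the starting record.) Put $W_\infty(\eta,x)=\sum_{k\in\mathbb N}\mathcal W_k(\eta,x)$ and define $T:\Omega\to\Omega$ by $T\eta(x)=\eta(x)+W_\infty(\eta,x-1)-W_\infty(\eta,x)$. For $k\in\mathbb N$, $\xi_k(\eta,\cdot):\mathbb Z\to\mathbb Z$ is defined by $\xi_k(\eta,s_\infty(\eta,0))=0$ and $\xi_k(\eta,x)-\xi_k(\eta,x-1)=1-\sum_{j=1}^{k}(\eta^\uparrow_j(x)+\eta^\downarrow_j(x))$; $s_k(\eta,x)=\min\{y\in\mathbb Z:\xi_k(\eta,y)=x\}$ ($\min\emptyset=\infty$); and $$\zeta_k(\eta,i)=\sum_{y\in\mathbb Z:\ s_k(\eta,i)<y\le s_k(\eta,i+1)}\big(\eta^{\uparrow}_k(y)-\eta^{\uparrow}_{k+1}(y)\big),$$ which is $0$ (empty sum) if $s_k(\eta,i)=\infty$ and runs over all integers $y>s_k(\eta,i)$ if only $s_k(\eta,i+1)=\infty$. *)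

(* Defs.v *)
From HB Require Import structures.
From mathcomp Require Export all_boot all_order all_algebra.
From mathcomp Require Export mathcomp_extra boolp classical_sets functions.
From mathcomp Require Export cardinality fsbigop reals ereal topology.
From mathcomp Require Export normedtype sequences.

Set Implicit Arguments.
Unset Strict Implicit.
Unset Printing Implicit Defensive.

Import Order.TTheory GRing.Theory Num.Theory.
Import numFieldNormedType.Exports.

Local Open Scope classical_set_scope.
Local Open Scope ring_scope.

(* Configurations are functions int -> int; being {0,1}-valued is part of
   [Omega]. Sums \sum_(i \in A) over a set are the finite-support sums of
   mathcomp.classical.fsbigop. Seats are numbered by the positive naturals:
   index 0 of a family indexed by nat carries no information and is never used.
   Objects that the theory characterizes by a property are selected by [xget];
   its default value is returned only when no such object exists. *)

Definition binary (eta : int -> int) : Prop :=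
  forall x, eta x = 0 \/ eta x = 1.

Definition Omega (R : realType) (eta : int -> int) : Prop :=
  binary eta /\
  exists2 l : R, l < 2^-1 &
    (fun n : nat =>
       (n%:R)^-1 * (\sum_(y \in [set y : int | - n%:Z <= y <= 0]) eta y)%:~R : R)
      @ \oo --> l.

Definition is_record (eta : int -> int) (x : int) : Prop :=
  forall z : int, z <= x ->
    \sum_(y \in [set y : int | z <= y <= x]) (2 * eta y - 1) < 0.

(* s_oo(eta, 0): the largest record <= 0. *)
Definition s_oo0 (eta : int -> int) : int :=
  xget 0 [set x : int | [/\ is_record eta x, x <= 0 &
    forall y : int, is_record eta y -> y <= 0 -> y <= x]].

Section Carrier.
Variables (eta : int -> int) (W : nat -> int -> int).

Definition seat_up (k : nat) (x : int) : int :=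
  eta x * (1 - W k (x - 1)) * \prod_(1 <= j < k) W j (x - 1).

Definition seat_down (k : nat) (x : int) : int :=
  (1 - eta x) * W k (x - 1) * \prod_(1 <= j < k) (1 - W j (x - 1)).

Definition is_carrier : Prop :=
  forall k : nat, (0 < k)%N ->
    [/\ binary (W k),
        forall x, is_record eta x -> W k x = 0 &
        forall x, W k x = W k (x - 1) + seat_up k x - seat_down k x].

End Carrier.

Definition carrier (eta : int -> int) : nat -> int -> int :=
  xget (fun _ _ => 0) [set W | is_carrier eta W].

Definition eta_up (eta : int -> int) : nat -> int -> int :=
  seat_up eta (carrier eta).

Definition eta_down (eta : int -> int) : nat -> int -> int :=
  seat_down eta (carrier eta).

(* Only finitely many seats are occupied at x, as the carrier is empty at the
   records to the left of x. *)
Definition W_oo (eta : int -> int) (x : int) : int :=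
  \sum_(k \in [set k : nat | (0 < k)%N]) carrier eta k x.

Definition T (eta : int -> int) (x : int) : int :=
  eta x + W_oo eta (x - 1) - W_oo eta x.

Definition is_xi (eta : int -> int) (k : nat) (f : int -> int) : Prop :=
  f (s_oo0 eta) = 0 /\
  forall x, f x - f (x - 1)
    = 1 - \sum_(1 <= j < k.+1) (eta_up eta j x + eta_down eta j x).

Definition xi (eta : int -> int) (k : nat) : int -> int :=
  xget (fun=> 0) [set f | is_xi eta k f].

(* min {y | xi_k(y) = x}, with min of the empty set = +oo. *)
Definition s (eta : int -> int) (k : nat) (x : int) : \bar int :=
  xget +oo%E [set m%:E | m in [set m : int | xi eta k m = x /\
    forall y, xi eta k y = x -> m <= y]].

(* The sum over s_k(i) < y <= s_k(i+1) is the series over y = a + 1, a + 2, ...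
   with a = s_k(i), restricted to y <= s_k(i+1). It has finitely many terms when
   s_k(i+1) is finite; otherwise xi_k is constant on [a, +oo[, so that seat k+1
   never changes there, the terms are nonnegative and the series converges
   in [0, +oo]. *)
Definition zeta (R : realType) (eta : int -> int) (k : nat) (i : int) : \bar R :=
  match s eta k i with
  | EFin a =>
      \sum_(0 <= n <oo | ((a + n.+1%:Z)%:E <= s eta k (i + 1))%E)
        ((eta_up eta k (a + n.+1%:Z) - eta_up eta k.+1 (a + n.+1%:Z))%:~R)%:E
  | _ => 0
  end%E.

Definition offset (eta : int -> int) (k : nat) : int :=
  s_oo0 eta - s_oo0 (T eta)
  + 2 * \sum_(y \in [set y : int | s_oo0 eta + 1 <= y <= 0])
          \sum_(1 <= l < k.+1) eta_down eta l y
  - 2 * \sum_(y \in [set y : int | s_oo0 (T eta) + 1 <= y <= 0])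
          \sum_(1 <= l < k.+1) eta_up (T eta) l y.

(* Main.v *)
(** Let [W] and [V] be the carriers of [eta] and [T eta]. Wherever seat [j] of [W] is
    occupied, every seat [i <= j] is occupied in exactly one of [W] and [V]; this
    holds vacuously at a record of [eta], where [W] is empty, and is preserved
    by each step. It follows that [(T eta)^up_k = eta^down_k], and hence that
    [xi_k (T eta) - xi_k eta - o_k] counts the occupied seats among the first [k]
    seats of [W] and [V]. That number is at most [k], with equality as soon
    as [W] occupies a seat numbered at least [k].
    So [s_k (T eta, i + k + o_k)] comes after [s_k (eta, i)], and between the two
    no seat [k] or [k+1] of [W] is vacated. As seats [k] and [k+1] of [W] agree at
    [s_k (eta, i)], counting [eta^up_k - eta^up_(k+1)] between consecutive slots of
    [eta] amounts to counting [eta^down_k - eta^down_(k+1)], that is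
    [(T eta)^up_k - (T eta)^up_(k+1)], and the endpoints may be moved to
    the slots of [T eta]. *)

Require Import Defs.
From mathcomp Require Import all_boot all_order all_algebra reals ereal.
From mathcomp Require Import zify ring lra.
Import Order.TTheory GRing.Theory Num.Theory.
Import numFieldNormedType.Exports.
Local Open Scope ring_scope.

(** * Functions on the integers with given increments *)

Lemma int_ind_ge (P : int -> Prop) (a : int) :
  P a -> (forall x, a < x -> P (x - 1) -> P x) -> forall x, a <= x -> P x.
Proof.
move=> Pa PS x ax; have -> : x = a + `|x - a|%N%:Z by lia.
elim: `|x - a|%N => [|n IH]; first by rewrite addr0.
apply: PS; first lia.
by have -> : a + n.+1%:Z - 1 = a + n%:Z by lia.
Qed.

Lemma int_min (P : int -> Prop) (b : int) :
  (forall x, P x -> b <= x) -> (exists x, P x) ->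
  exists m, P m /\ forall x, P x -> m <= x.
Proof.
move=> Pb [x Px]; have : exists n : nat, `[< P (b + n%:Z) >].
  exists `|x - b|%N; apply/asboolP.
  by have -> : b + `|x - b|%N%:Z = x by have := Pb _ Px; lia.
move=> /ex_minnP[n /asboolP Pn nmin]; exists (b + n%:Z); split => // y Py.
have by_ := Pb _ Py; have /nmin : `[< P (b + `|y - b|%N%:Z) >]; last lia.
by apply/asboolP; have -> : b + `|y - b|%N%:Z = y by lia.
Qed.

Definition primitive (g f : int -> int) : Prop := forall x, f x - f (x - 1) = g x.

Lemma primitive_exists (g : int -> int) (a c : int) :
  exists f, f a = c /\ primitive g f.
Proof.
pose f0 (x : int) : int := match x with
  | Posz n => \sum_(0 <= j < n) g (j.+1%:Z)
  | Negz n => - \sum_(0 <= j < n.+1) g (- j%:Z) end.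
have f0P : primitive g f0.
  move=> [[|n]|n].
  - have -> : Posz 0 - 1 = Negz 0 by [].
    by rewrite /f0 big_nat1 big_geq // opprK add0r oppr0.
  - have -> : Posz n.+1 - 1 = Posz n by lia.
    by rewrite /f0 big_nat_recr //= addrAC subrr add0r.
  - have -> : Negz n - 1 = Negz n.+1 by lia.
    rewrite /f0 [in X in _ - X]big_nat_recr //= NegzE.
    by rewrite opprK addKr.
exists (fun x => f0 x - f0 a + c); split; first by rewrite subrr add0r.
by move=> x; rewrite -f0P; ring.
Qed.

Lemma primitive_diff {g f1 f2 : int -> int} (a : int) :
  primitive g f1 -> primitive g f2 -> forall x, f1 x - f1 a = f2 x - f2 a.
Proof.
move=> p1 p2; have [f [_ pf]] := primitive_exists g 0 0.
have key x y : x <= y -> f1 y - f1 x = f2 y - f2 x.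
  move: y; apply: int_ind_ge => [|y _ IH]; first by rewrite !subrr.
  by have := p1 y; have := p2 y; lia.
by move=> x; have [ax|/ltW xa] := leP a x; [exact: key|have := key _ _ xa; lia].
Qed.

(** Telescoping. The empty sum [x = z - 1] is included: it occurs in [offset] when the largest
    record up to 0 is 0 itself. *)
Lemma primitive_sum (g f : int -> int) (z x : int) : primitive g f ->
  z - 1 <= x -> \sum_(y \in [set y : int | z <= y <= x]%classic) g y = f x - f (z - 1).
Proof.
move=> fP zx; have -> : x = z - 1 + (absz (x - (z - 1))%R)%:Z by lia.
move: (absz _) => {zx x} n.
rewrite (fsbig_fwiden [seq (z + i%:Z)%R | i <- index_iota 0 n]); last 3 first.
- move=> y /= zyx; apply/mapP; exists `|y - z|%N; last lia.
  by rewrite mem_index_iota; lia.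
- by rewrite map_inj_uniq ?iota_uniq // => i j; lia.
- by move=> y /= [/mapP[i]]; rewrite mem_index_iota; lia.
rewrite big_map; elim: n => [|n IH]; first by rewrite big_geq // addr0 subrr.
rewrite big_nat_recr //= IH; have := fP (z + n%:Z).
have -> : z - 1 + n.+1%:Z = z + n%:Z by lia.
have -> : z - 1 + n%:Z = z + n%:Z - 1 by lia.
lia.
Qed.

(** * One step of the carrier *)

Definition seats01 (W : nat -> int -> int) (x : int) : Prop :=
  forall k, (0 < k)%N -> W k x = 0 \/ W k x = 1.

Lemma prod_binary (f : nat -> int) (m n : nat) :
  (forall j, (m <= j < n)%N -> f j = 0 \/ f j = 1) ->
  (\prod_(m <= j < n) f j = 1 /\ forall j, (m <= j < n)%N -> f j = 1) \/
  (\prod_(m <= j < n) f j = 0 /\ exists2 j, (m <= j < n)%N & f j = 0).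
Proof.
elim: n => [|n IH] f01; first by left; rewrite big_geq //; split => // j; lia.
have [mn|nm] := leqP m n; last by left; rewrite big_geq //; split => // j; lia.
rewrite big_nat_recr //=; have [|[-> H]|[-> [j jn fj]]] := IH.
- by move=> j jn; apply: f01; lia.
- have [fn|fn] := f01 n ltac:(lia).
    by right; rewrite fn mulr0; split => //; exists n; [lia|].
  left; rewrite fn mulr1; split => // j jn.
  by have [->//|jn'] := eqVneq j n; apply: H; lia.
- by right; rewrite mul0r; split => //; exists j => //; lia.
Qed.

(** Symmetry between balls and holes, which transfers formulas for [seat_up] to [seat_down]. *)
Lemma seat_downE (eta : int -> int) (W : nat -> int -> int) (k : nat) (x : int) :
  seat_down eta W k x = seat_up (fun x => 1 - eta x) (fun k x => 1 - W k x) k x.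
Proof. by rewrite /seat_down /seat_up subKr. Qed.

(** A ball takes the lowest empty seat [m]: below [m] the factor [1 - W k] vanishes, and above [m]
    the product contains [W m = 0]. *)
Lemma seat_up_first {eta : int -> int} {W : nat -> int -> int} {x : int} {m : nat} :
  (0 < m)%N -> W m (x - 1) = 0 -> (forall l, (0 < l < m)%N -> W l (x - 1) = 1) ->
  forall k, (0 < k)%N -> seat_up eta W k x = if k == m then eta x else 0.
Proof.
move=> m0 Wm Wl k k0; rewrite /seat_up; case: (ltngtP k m) => [km|mk|->].
- by rewrite Wl ?k0 // subrr mulr0 mul0r.
- rewrite (big_cat_nat _ (n := m)) //=; last lia.
  by rewrite [X in _ * (_ * X)]big_ltn // Wm mul0r !mulr0.
- rewrite Wm subr0 mulr1 big_nat_cond big1 ?mulr1 // => j jm; apply: Wl; lia.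
Qed.

Lemma seat_down_first {eta : int -> int} {W : nat -> int -> int} {x : int} {m : nat} :
  (0 < m)%N -> W m (x - 1) = 1 -> (forall l, (0 < l < m)%N -> W l (x - 1) = 0) ->
  forall k, (0 < k)%N -> seat_down eta W k x = if k == m then 1 - eta x else 0.
Proof.
move=> m0 Wm Wl k k0; rewrite seat_downE (seat_up_first m0) // ?Wm ?subrr //.
by move=> l /Wl ->; rewrite subr0.
Qed.

(** Each term is [eta x] times a difference of two consecutive partial products, so the sum
    telescopes. *)
Lemma sum_seat_up (eta : int -> int) (W : nat -> int -> int) (k : nat) (x : int) :
  \sum_(1 <= j < k.+1) seat_up eta W j x =
  eta x * (1 - \prod_(1 <= j < k.+1) W j (x - 1)).
Proof.
elim: k => [|k IH]; first by rewrite !big_geq // subrr mulr0.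
rewrite big_nat_recr //= IH [in RHS]big_nat_recr //= /seat_up; ring.
Qed.

Lemma sum_seat_down (eta : int -> int) (W : nat -> int -> int) (k : nat) (x : int) :
  \sum_(1 <= j < k.+1) seat_down eta W j x =
  (1 - eta x) * (1 - \prod_(1 <= j < k.+1) (1 - W j (x - 1))).
Proof.
by rewrite (eq_bigr _ (fun j _ => seat_downE eta W j x)) sum_seat_up.
Qed.

Definition carrier_step (eta : int -> int) (W : nat -> int -> int) (x : int) : Prop :=
  forall k, (0 < k)%N -> W k x = W k (x - 1) + seat_up eta W k x - seat_down eta W k x.

Lemma seats01_step {eta : int -> int} {W : nat -> int -> int} {x : int} :
  binary eta -> seats01 W (x - 1) -> carrier_step eta W x -> seats01 W x.
Proof.
move=> e01 W01 step k k0; rewrite step // /seat_up /seat_down.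
have p1 : forall j, (1 <= j < k)%N -> W j (x - 1) = 0 \/ W j (x - 1) = 1.
  by move=> j jk; apply: W01; lia.
have p2 : forall j, (1 <= j < k)%N -> 1 - W j (x - 1) = 0 \/ 1 - W j (x - 1) = 1.
  by move=> j jk; have := W01 j ltac:(lia); lia.
by case: (e01 x) => ->; case: (W01 k k0) => ->;
  case: (prod_binary _ _ _ p1) => [][-> _]; case: (prod_binary _ _ _ p2) => [][-> _]; lia.
Qed.

Lemma slot_step01 (eta : int -> int) (W : nat -> int -> int) (k : nat) (x : int) :
  binary eta -> seats01 W (x - 1) ->
  \sum_(1 <= j < k.+1) (seat_up eta W j x + seat_down eta W j x) = 0 \/
  \sum_(1 <= j < k.+1) (seat_up eta W j x + seat_down eta W j x) = 1.
Proof.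
move=> e01 W01; rewrite big_split sum_seat_up sum_seat_down /=.
have [|[-> _]|[-> _]] := prod_binary (fun j => W j (x - 1)) 1 k.+1.
- by move=> j jk; apply: W01; lia.
- have [|[-> _]|[-> _]] := prod_binary (fun j => 1 - W j (x - 1)) 1 k.+1.
  + by move=> j jk; have := W01 j ltac:(lia); lia.
  + by case: (e01 x) => ->; lia.
  + by case: (e01 x) => ->; lia.
- have [|[-> _]|[-> _]] := prod_binary (fun j => 1 - W j (x - 1)) 1 k.+1.
  + by move=> j jk; have := W01 j ltac:(lia); lia.
  + by case: (e01 x) => ->; lia.
  + by case: (e01 x) => ->; lia.
Qed.

(* At a site where no seat up to [k] changes, seats [1..k] are all occupied
   (resp. all empty) before the site, so that seat [k+1] ends up occupied
   (resp. empty) as well. *)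
Lemma slot_seats_eq (eta : int -> int) (W : nat -> int -> int) (k : nat) (x : int) :
  (0 < k)%N -> binary eta -> seats01 W (x - 1) -> carrier_step eta W x ->
  \sum_(1 <= j < k.+1) (seat_up eta W j x + seat_down eta W j x) != 1 ->
  W k x = W k.+1 x.
Proof.
move=> k0 e01 W01 step; rewrite big_split sum_seat_up sum_seat_down /=.
rewrite !step // /seat_up /seat_down.
case: (e01 x) => -> sn.
- have [|[p1 a1]|[p1 a1]] := prod_binary (fun j => 1 - W j (x - 1)) 1 k.+1.
  + by move=> j jk; have := W01 j ltac:(lia); lia.
  + by rewrite p1; have := a1 k ltac:(lia); lia.
  + by move: sn; rewrite p1; lia.
- have [|[p1 a1]|[p1 a1]] := prod_binary (fun j => W j (x - 1)) 1 k.+1.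
  + by move=> j jk; have := W01 j ltac:(lia); lia.
  + by rewrite p1; have := a1 k ltac:(lia); lia.
  + by move: sn; rewrite p1; lia.
Qed.

(** * Records, existence of the carrier, and the height of [T eta] *)

Definition height (eta H : int -> int) : Prop := primitive (fun y => 2 * eta y - 1) H.

(** Divergence to [+oo] towards the left: the form in which the density condition enters the
    construction of records and carriers. *)
Definition escapes (H : int -> int) : Prop :=
  forall B, exists N, forall z, z <= N -> B <= H z.

(** The leftmost minimum point of [H] over the sites up to [x]; for a height it is the largest
    record up to [x]. *)
Definition last_record (H : int -> int) (x r : int) : Prop :=
  [/\ r <= x, forall z, z <= x -> H r <= H z & forall z, z < r -> H r < H z].

Lemma is_recordP {eta H : int -> int} {x : int} : height eta H ->
  is_record eta x <-> forall z, z < x -> H x < H z.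
Proof.
move=> hH; split=> [rec z zx|rec z zx].
  have := rec (z + 1); rewrite (primitive_sum _ _ _ _ hH) ?addrK; last lia.
  by move=> /(_ ltac:(lia)); lia.
rewrite (primitive_sum _ _ _ _ hH); last lia.
by have := rec (z - 1); lia.
Qed.

Lemma last_record_is_record {eta H : int -> int} {x r : int} : height eta H ->
  last_record H x r -> is_record eta r.
Proof. by move=> hH [_ _ rz]; apply/(is_recordP hH). Qed.

(** [escapes] bounds [H] from below far to the left and the slope bound [step] does so on the rest,
    so a minimal value exists; [escapes] once more yields a leftmost site with that value. *)
Lemma last_record_exists (eta H : int -> int) (x : int) :
  binary eta -> height eta H -> escapes H -> exists r, last_record H x r.
Proof.
move=> e01 hH esc.
have step z : z <= x -> H x <= H z + (x - z).
  move: x; apply: int_ind_ge => [|y zy IH]; first lia.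
  by have := hH y; case: (e01 y) => ->; lia.
have [N HN] := esc (H x).
have [v [[z [zx zv]] vmin]] : exists v, (exists z, z <= x /\ H z = v) /\
    forall v', (exists z, z <= x /\ H z = v') -> v <= v'.
  apply: (int_min _ (H x - `|x - N|%N%:Z)); last by exists (H x), x.
  move=> v [z [zx <-]]; have [/HN|] := leP z N; first lia.
  by have := step z zx; lia.
have [N' HN'] := esc (v + 1).
have [r [[rx rv] rmin]] : exists r, (r <= x /\ H r = v) /\
    forall r', (r' <= x /\ H r' = v) -> r <= r'.
  apply: (int_min _ N'); last by exists z.
  by move=> r [rx rv]; have [|/ltW/HN'] := leP N' r => //; lia.
exists r; split=> // y yr; first by rewrite rv; apply: vmin; exists y.
rewrite lt_neqAle rv vmin ?andbT; last by exists y; split => //; lia.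
by apply/eqP => vy; have := rmin y; lia.
Qed.

Lemma last_record_unique {H : int -> int} {x r r' : int} :
  last_record H x r -> last_record H x r' -> r = r'.
Proof.
move=> [rx rz rl] [rx' rz' rl'].
by case: (ltgtP r r') => // [/rl'|/rl]; have := rz r' rx'; have := rz' r rx; lia.
Qed.

Lemma last_record_step {H : int -> int} {x r : int} : last_record H (x - 1) r ->
  (H r <= H x /\ last_record H x r) \/ (H x < H r /\ last_record H x x).
Proof.
move=> [rx rz rl]; have [rx'|xr] := leP (H r) (H x); [left|right]; split => //.
  split=> // [|z zx]; first lia.
  by have [->//|zx'] := eqVneq z x; apply: rz; lia.
split=> // z zx; last by have := rz z; lia.
by have [->//|zx'] := eqVneq z x; have := rz z; lia.
Qed.

(** A carrier that is empty at [r] gains one ball when [H] goes up and loses one when [H] goes down,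
    and at most one new seat comes into use per site. *)
Lemma run_count {eta H : int -> int} {W : nat -> int -> int} {r x : int} :
  binary eta -> height eta H -> (forall k, (0 < k)%N -> W k r = 0) ->
  (forall y, r < y -> y <= x -> carrier_step eta W y) ->
  (forall y, y <= x -> H r <= H y) ->
  forall y, r <= y -> y <= x ->
  [/\ seats01 W y, forall k, y - r < k%:Z -> W k y = 0 &
      forall N, y - r < N%:Z -> \sum_(1 <= k < N) W k y = H y - H r].
Proof.
move=> e01 hH W0 step Hr; apply: int_ind_ge => [_|y ry IH yx].
  split=> [k k0|k rk|N _]; [by left; apply: W0|by apply: W0; lia|].
  by rewrite subrr big_nat_cond big1 // => j jN; apply: W0; lia.
have {IH} [IH01 IHW IHN] := IH ltac:(lia).
have st := step y ry yx.
split=> [|k yk|N yN]; first exact: seats01_step.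
  rewrite st; last lia.
  rewrite /seat_up /seat_down IHW ?mulr0 ?mul0r; last lia.
  case: k yk => [|[|k]] yk; [lia|lia|].
  rewrite big_nat_recr //= (IHW k.+1); [ring|lia].
case: N yN => [|[|N]] yN; [lia|lia|].
rewrite (eq_big_nat _ _ (F2 := fun j => (W j (y - 1) + seat_up eta W j y) - seat_down eta W j y));
  last by move=> j jN; apply: st; lia.
rewrite sumrB big_split /= IHN; last lia.
rewrite sum_seat_up sum_seat_down.
(* Seat [N.+1] is still empty, so an arriving ball finds a seat among those counted. *)
have -> : \prod_(1 <= j < N.+2) W j (y - 1) = 0.
  by rewrite big_nat_recr //= (IHW N.+1) ?mulr0 //; lia.
have := hH y; case: (e01 y) => ->; last lia.
(* A hole meeting an empty carrier would bring the height below [H r]. *)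
have [|[-> a1]|[-> _]] := prod_binary (fun j => 1 - W j (y - 1)) 1 N.+2; last lia.
  by move=> j jk; have := IH01 j ltac:(lia); lia.
have := IHN N.+2 ltac:(lia); rewrite big_nat_cond big1; last first.
  by move=> j jN; have := a1 j ltac:(lia); lia.
by have := Hr y yx; lia.
Qed.

Lemma seats_empty {W : nat -> int -> int} {x : int} {N : nat} : seats01 W x ->
  \sum_(1 <= j < N) W j x = 0 -> forall k, (0 < k < N)%N -> W k x = 0.
Proof.
move=> W01; elim: N => [|[|N] IH] W0 k kN; [lia|lia|].
have s0 : 0 <= \sum_(1 <= j < N.+1) W j x.
  rewrite big_nat_cond sumr_ge0 // => j; rewrite andbT => jN.
  by have := W01 j ltac:(lia); lia.
have E : \sum_(1 <= j < N.+2) W j x = \sum_(1 <= j < N.+1) W j x + W N.+1 x.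
  by rewrite big_nat_recr.
move: W0 s0 IH; rewrite {}E; move: (\sum_(1 <= j < N.+1) _) => S W0 S0 IH.
have WN := W01 N.+1 isT; have [->|kN'] := eqVneq k N.+1; first lia.
by apply: IH; lia.
Qed.

(** The carrier [n] sites after starting empty at [r]. The family [w] ignores its site, since
    [seat_up] and [seat_down] read only the state before the step. *)
Fixpoint run (eta : int -> int) (r : int) (n : nat) (k : nat) : int :=
  if n is n'.+1 then
    let w (j : nat) (_ : int) := run eta r n' j in
    run eta r n' k + seat_up eta w k (r + n%:Z) - seat_down eta w k (r + n%:Z)
  else 0.

Lemma run_step (eta : int -> int) (r y : int) : r < y ->
  carrier_step eta (fun k y => run eta r `|y - r|%N k) y.
Proof.
move=> ry k k0; have -> : `|y - r|%N = `|(y - 1)%R - r|%N.+1 by lia.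
rewrite /=; have -> : r + `|(y - 1)%R - r|%N.+1%:Z = y by lia.
by [].
Qed.

(** The value at [x] is that of the run started at the last record [r x]. If [r x = r (x - 1)], the
    recursion is that of the run. Otherwise [x] is a record, and the counting formula shows that the
    old run is empty at [x - 1], so that restarting at [x] agrees with the recursion. *)
Lemma carrier_exists (eta H : int -> int) :
  binary eta -> height eta H -> escapes H -> exists W, is_carrier eta W.
Proof.
move=> e01 hH esc.
have /choice[r rP] : forall x, exists r, last_record H x r.
  by move=> x; apply: last_record_exists.
pose w (x : int) (k : nat) (y : int) := run eta (r x) `|y - r x|%N k.
have cnt x : [/\ seats01 (w x) x, forall k, x - r x < k%:Z -> w x k x = 0 &
    forall N, x - r x < N%:Z -> \sum_(1 <= k < N) w x k x = H x - H (r x)].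
  have [rx Hr _] := rP x; apply: (run_count e01 hH _ _ Hr) => // [k _|y ry _].
    by rewrite /w subrr.
  exact: run_step.
exists (fun k x => w x k x) => k k0; split.
- by move=> x; have [W01 _ _] := cnt x; apply: W01.
- move=> x /(is_recordP hH) xrec; suff rE : r x = x by rewrite /w rE subrr.
  apply: (last_record_unique (rP x)); split=> // z zx.
  by have [->//|zx'] := eqVneq z x; apply/ltW/xrec; lia.
- move=> x; case: (last_record_step (rP (x - 1))) => [[_ /last_record_unique]|[Hx]].
    move=> /(_ _ (rP x)) rE; rewrite /seat_up /seat_down /w rE.
    by apply: (run_step eta (r x) x) => //; have [] := rP (x - 1); lia.
  move=> /last_record_unique/(_ (rP x)) rE; rewrite {1}/w -rE subrr /=.
  have [W01 Wlarge Wsum] := cnt (x - 1).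
  have [rx Hr _] := rP (x - 1); have Hx1 := Hr (x - 1) (lexx _).
  have := hH x; case: (e01 x) => ex; rewrite ex => Hstep; last lia.
  suff W0 j : (0 < j)%N -> w (x - 1) j (x - 1) = 0.
    by rewrite /seat_up /seat_down ex W0 //; ring.
  move=> j0; apply: (seats_empty (N := (j + absz (x - r (x - 1))%R).+1) W01); last lia.
  by rewrite Wsum; lia.
Qed.

Lemma carrierP {eta H : int -> int} :
  binary eta -> height eta H -> escapes H -> is_carrier eta (carrier eta).
Proof.
move=> e01 hH esc; have [W WP] := carrier_exists _ _ e01 hH esc.
exact: (xgetI _ (P := [set W | is_carrier eta W]%classic) WP).
Qed.

Lemma carrier_count {eta H : int -> int} {W : nat -> int -> int} {x r : int} :
  binary eta -> height eta H -> is_carrier eta W -> last_record H x r ->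
  [/\ forall k, (0 < k)%N -> W k r = 0, forall k, x - r < k%:Z -> W k x = 0 &
      forall N, x - r < N%:Z -> \sum_(1 <= k < N) W k x = H x - H r].
Proof.
move=> e01 hH WP lr; have W0 k : (0 < k)%N -> W k r = 0.
  by move=> k0; have [_ -> //] := WP k k0; apply: last_record_is_record lr.
have [rx Hr _] := lr; have [_ ? ?] := run_count e01 hH W0
  (fun y _ _ k k0 => let: And3 _ _ h := WP k k0 in h y) Hr x rx (lexx x).
by split.
Qed.

(** Seats numbered above [x - r] are empty at [x], so the sum reduces to the finite one in
    [carrier_count]. *)
Lemma W_ooE {eta H : int -> int} {x r : int} :
  binary eta -> height eta H -> escapes H -> last_record H x r ->
  W_oo eta x = H x - H r.
Proof.
move=> e01 hH esc lr.
have [_ Wl Ws] := carrier_count e01 hH (carrierP e01 hH esc) lr.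
have [rx _ _] := lr; rewrite /W_oo (fsbigE (index_iota 1 `|x - r|%N.+1)).
- rewrite big_seq_cond (eq_bigl (fun k => k \in index_iota 1 `|x - r|%N.+1)).
    by rewrite -big_seq Ws //; lia.
  move=> k; rewrite mem_index_iota; case: (boolP (0 < k < _)%N) => //= k0.
  by apply: mem_set => /=; lia.
- exact: iota_uniq.
- by move=> k /=; rewrite mem_index_iota; lia.
- by move=> k /= k0; rewrite mem_index_iota => kl; apply: Wl; lia.
Qed.

(* Pitman's transformation: the height of [T eta] is [2 M - H], where
   [M x = H (r x)] is the running minimum of the height [H] of [eta]. *)
Lemma height_T {eta H r : int -> int} :
  binary eta -> height eta H -> escapes H -> (forall x, last_record H x (r x)) ->
  height (T eta) (fun x => 2 * H (r x) - H x).
Proof.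
move=> e01 hH esc rP x; rewrite /T (W_ooE e01 hH esc (rP x)).
by rewrite (W_ooE e01 hH esc (rP (x - 1))); have := hH x; lia.
Qed.

(** Away from records [W_oo] changes by [2 * eta x - 1], which leaves [1 - eta x]; at a record
    everything vanishes. *)
Lemma binary_T {eta H : int -> int} :
  binary eta -> height eta H -> escapes H -> binary (T eta).
Proof.
move=> e01 hH esc x; have [r rP] := last_record_exists _ _ (x - 1) e01 hH esc.
rewrite /T (W_ooE e01 hH esc rP); have [rx Hr _] := rP.
case: (last_record_step rP) => [] [Hx rP']; rewrite (W_ooE e01 hH esc rP').
  by have := hH x; case: (e01 x); lia.
by have := Hr (x - 1) (lexx _); have := hH x; case: (e01 x); lia.
Qed.

(** * The height of a configuration in [Omega] *)

(** With limiting density [l], the height at [- n - 1] grows like [(1 - 2 * l) * n]. The error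
    [c / 8] is made of [c / 16] for twice the density error [c / 32] and [c / 16] for the constant
    [H 0 + 1]. *)
Lemma Omega_height_linear {R : realType} {eta H : int -> int} :
  Omega R eta -> height eta H -> exists2 c : R, 0 < c & exists N : nat,
    forall n : nat, (N <= n)%N -> `|(H (- n%:Z - 1))%:~R - c * n%:R| <= c / 8 * n%:R.
Proof.
move=> [e01 [l l2 cvl]] hH; exists (1 - 2 * l); first by lra.
have [E [_ hE]] := primitive_exists eta 0 0.
set c := 1 - 2 * l; have c0 : 0 < c by rewrite /c; lra.
have c32 : 0 < c / 32 by lra.
move/cvgrPdist_le: cvl => /(_ _ c32)[N1 _ HN1].
pose b : R := `|(H 0 + 1)%:~R| * 16 / c.
exists (maxn N1 (maxn 1 (Num.bound b))) => n; rewrite !geq_max => /and3P[nN n1 nb].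
have n0 : 0 < n%:R :> R by rewrite ltr0n.
have := HN1 n nN; rewrite /= (primitive_sum _ _ _ _ hE); last lia.
have HE : H (- n%:Z - 1) = H 0 + n%:Z + 1 - 2 * (E 0 - E (- n%:Z - 1)).
  have h2 : height eta (fun x => 2 * E x - x) by move=> x; have := hE x; lia.
  by have := primitive_diff 0 hH h2 (- n%:Z - 1); lia.
rewrite HE; move: (E 0 - _) => A; move: (H 0) @b nb => h b nb.
have bn : `|(h + 1)%:~R| <= c / 16 * n%:R :> R.
  have : b < n%:R.
    by apply: lt_le_trans (archi_boundP _) _; rewrite ?ler_nat //;
      rewrite /b divr_ge0 ?mulr_ge0 //; lra.
  by rewrite /b ltr_pdivrMr // => bnc; lra.
have nV : n%:R * (n%:R^-1 * A%:~R) = A%:~R :> R by rewrite mulrA mulfV ?mul1r ?gt_eqF.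
move: (n%:R^-1 * _) nV => a nV ab.
have : `|l * n%:R - A%:~R| <= c / 32 * n%:R :> R.
  have -> : l * n%:R - A%:~R = (l - a) * n%:R by rewrite -nV; ring.
  by rewrite normrM (gtr0_norm n0) ler_wpM2r // ltW.
have -> : (h + n%:Z + 1 - 2 * A)%:~R = (h + 1)%:~R + n%:R - 2 * A%:~R :> R.
  by rewrite !(rmorphD, rmorphN, rmorphM) /=; ring.
move: bn; move: ((h + 1)%:~R) (A%:~R) (n%:R) => u v w; rewrite !ler_norml.
rewrite /c; lra.
Qed.

(** Writing [z = - n - 1] and [r z = - m - 1] with [n <= m], the value is at least
    [2 * (7/8) * c * m - (9/8) * c * n], hence at least [(5/8) * c * n]. The identity for [r] gives
    the height of [eta], the last records give that of [T eta]. *)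
Lemma Omega_escapes {R : realType} {eta H r : int -> int} :
  Omega R eta -> height eta H -> (forall x, r x <= x) ->
  escapes (fun x => 2 * H (r x) - H x).
Proof.
move=> Om hH rx B; have [c c0 [N HN]] := Omega_height_linear Om hH.
pose b : R := `|B%:~R| * 8 / 5 / c.
exists (- (maxn N (Num.bound b))%:Z - 1) => z zN.
have [n zn] : exists n : nat, z = - n%:Z - 1 by exists (absz (z + 1)%R); lia.
have [m rm] : exists m : nat, r z = - m%:Z - 1 by exists (absz (r z + 1)%R); have := rx z; lia.
have nm : (n <= m)%N by have := rx z; lia.
have := HN n ltac:(lia); have := HN m ltac:(lia); rewrite -zn -rm.
have nb : b < n%:R.
  by apply: lt_le_trans (archi_boundP _) _; rewrite ?ler_nat; [
    rewrite /b !divr_ge0 ?mulr_ge0 // ltW | lia].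
have nmR : c * n%:R <= c * m%:R by rewrite ler_pM2l ?ler_nat.
move: nb; rewrite /b ltr_pdivrMr // => nb; rewrite !ler_norml => h1 h2.
rewrite -(ler_int R) rmorphB rmorphM /=; have := ler_norm (B%:~R : R); lra.
Qed.

(** * Complementarity of the carriers of [eta] and [T eta] *)

Definition complementary (W V : nat -> int -> int) (x : int) : Prop :=
  forall i j, (0 < i <= j)%N -> W j x = 1 -> V i x + W i x = 1.

Lemma first_seat {W : nat -> int -> int} {x : int} (a : int) :
  (exists2 k, (0 < k)%N & W k x = a) ->
  exists m, [/\ (0 < m)%N, W m x = a & forall l, (0 < l < m)%N -> W l x <> a].
Proof.
move=> [k k0 Wk]; have ex : exists n, (0 < n)%N && (W n x == a).
  by exists k; rewrite k0 Wk eqxx.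
have /ex_minnP[m /andP[m0 /eqP Wm] mmin] := ex.
exists m; split => // l /andP[l0 lm] /eqP Wl.
by have := mmin l; rewrite l0 Wl => /(_ isT); lia.
Qed.

(** The condition on [eta' x] describes [T eta]: holes become balls exactly when the carrier [W] is
    nonempty. If [W] vacates its lowest occupied seat [m], then [V] is full below [m] and empty at
    [m], so its ball enters seat [m]. If [W] fills its lowest empty seat [m], then [V] is empty
    below [m]; it vacates [m] if that seat is occupied, and otherwise keeps all seats up to [m]. *)
Lemma complementary_step {eta eta' : int -> int} {W V : nat -> int -> int} {x : int} :
  binary eta -> seats01 W (x - 1) -> seats01 V (x - 1) ->
  carrier_step eta W x -> carrier_step eta' V x ->
  (exists2 k, (0 < k)%N & W k (x - 1) = 0) ->
  eta' x = (if `[< exists2 k, (0 < k)%N & W k (x - 1) = 1 >] then 1 - eta x else 0) ->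
  complementary W V (x - 1) ->
  complementary W V x /\
  forall k, (0 < k)%N -> seat_up eta' V k x = seat_down eta W k x.
Proof.
move=> e01 W01 V01 Wst Vst Wfin e'x comp.
have WVst i : (0 < i)%N -> V i x + W i x = V i (x - 1) + W i (x - 1)
    + seat_up eta' V i x - seat_down eta' V i x + seat_up eta W i x - seat_down eta W i x.
  by move=> i0; rewrite Vst // Wst //; ring.
case: (e01 x) => ex.
- have up0 k : seat_up eta W k x = 0 by rewrite /seat_up ex !mul0r.
  case: (pselect (exists2 k, (0 < k)%N & W k (x - 1) = 1)) => Wk; last first.
    have W0 k : (0 < k)%N -> W k (x - 1) = 0.
      by move=> k0; case: (W01 k k0) => // Wk1; case: Wk; exists k.
    move: e'x; rewrite asboolF // => e'x; split=> [i j ij|k k0].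
      rewrite Wst; last lia.
      by rewrite /seat_up /seat_down ex W0; lia.
    by rewrite /seat_up /seat_down e'x W0 // mulr0 !mul0r.
  have [m [m0 Wm Wl]] := first_seat 1 Wk.
  have {}Wl l : (0 < l < m)%N -> W l (x - 1) = 0.
    by move=> lm; have := Wl l lm; case: (W01 l); lia.
  have Vm : V m (x - 1) = 0 by have := comp m m ltac:(lia) Wm; lia.
  have Vl l : (0 < l < m)%N -> V l (x - 1) = 1.
    by move=> lm; have := comp l m ltac:(lia) Wm; rewrite Wl //; lia.
  move: e'x; rewrite asboolT // ex subr0 => e'x.
  have up' := seat_up_first (eta := eta') m0 Vm Vl.
  have down := seat_down_first (eta := eta) m0 Wm Wl.
  split=> [i j ij|k k0]; last by rewrite up' // down // e'x ex.
  have [i0 j0] : (0 < i)%N /\ (0 < j)%N by lia.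
  rewrite Wst // up0 down // WVst // up' // up0 down // e'x ex.
  have -> : seat_down eta' V i x = 0 by rewrite /seat_down e'x subrr !mul0r.
  have [->|_] := eqVneq j m; first by rewrite Wm; lia.
  by have := comp i j ij; case: (i == m); lia.
- have e'0 : eta' x = 0 by move: e'x; case: asboolP => _ ->; rewrite ?ex.
  have down0 k : seat_down eta W k x = 0 by rewrite /seat_down ex subrr !mul0r.
  have up0 k : seat_up eta' V k x = 0 by rewrite /seat_up e'0 !mul0r.
  have [m [m0 Wm Wl]] := first_seat 0 Wfin.
  have {}Wl l : (0 < l < m)%N -> W l (x - 1) = 1.
    by move=> lm; have := Wl l lm; case: (W01 l); lia.
  have Vl l : (0 < l < m)%N -> V l (x - 1) = 0.
    by move=> lm; have := comp l l ltac:(lia) (Wl l lm); rewrite Wl //; lia.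
  have up := seat_up_first (eta := eta) m0 Wm Wl.
  split=> [i j ij|k k0]; last by rewrite up0 down0.
  have [i0 j0] : (0 < i)%N /\ (0 < j)%N by lia.
  rewrite Wst // up // down0 WVst // up // up0 down0 ex.
  have cij := comp i j ij.
  case: (V01 m m0) => Vm.
  + have dn l : (0 < l <= m)%N -> seat_down eta' V l x = 0.
      move=> lm; suff Vl0 : V l (x - 1) = 0 by rewrite /seat_down Vl0 mulr0 mul0r.
      by have [->//|lm'] := eqVneq l m; apply: Vl; lia.
    have [im|mi] := leqP i m.
      rewrite dn; last lia.
      have [->|im'] := eqVneq i m; first by rewrite Vm Wm /=; lia.
      have im2 : (0 < i < m)%N by lia.
      by rewrite (Vl i) // (Wl i) //=; lia.
    have -> : (j == m) = false by lia.
    (* Seat [m] was empty in both carriers, which by complementarity excludes an occupied seat of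
       [W] above [m]. *)
    move=> Wj; have := comp m j ltac:(lia) ltac:(lia); lia.
  + have dn := seat_down_first (eta := eta') m0 Vm Vl.
    rewrite dn // e'0.
    have [->|im] := eqVneq i m; first by rewrite Vm Wm /=; lia.
    have [jm|jm] := eqVneq j m; last lia.
    have im2 : (0 < i < m)%N by lia.
    by rewrite (Vl i) // (Wl i) //=; lia.
Qed.

(** Induction to the right from a record. The condition on [T eta] in the single step is read off
    the heights: [W] is nonempty at [x - 1] exactly when [H (r (x - 1)) < H (x - 1)]. *)
Lemma complementary_carriers {eta H r : int -> int} {W V : nat -> int -> int} :
  binary eta -> height eta H -> escapes H -> (forall x, last_record H x (r x)) ->
  is_carrier eta W -> is_carrier (T eta) V ->
  (forall x, complementary W V x) /\
  forall k x, (0 < k)%N -> seat_up (T eta) V k x = seat_down eta W k x.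
Proof.
move=> e01 hH esc rP WP VP.
have W01 x : seats01 W x by move=> k k0; have [b _ _] := WP k k0.
have V01 x : seats01 V x by move=> k k0; have [b _ _] := VP k k0.
have Wst x : carrier_step eta W x by move=> k k0; have [_ _ ->] := WP k k0.
have Vst x : carrier_step (T eta) V x by move=> k k0; have [_ _ ->] := VP k k0.
have step (x : int) : complementary W V (x - 1) -> complementary W V x /\
  forall k, (0 < k)%N -> seat_up (T eta) V k x = seat_down eta W k x.
  have [W0 Wl Ws] := carrier_count e01 hH WP (rP (x - 1)).
  apply: complementary_step => //.
    by exists `|(x - 1)%R - r (x - 1)%R|.+1%N => //; apply: Wl; lia.
  rewrite /T (W_ooE e01 hH esc (rP x)) (W_ooE e01 hH esc (rP (x - 1))).
  have [rx Hr _] := rP (x - 1); have Hx1 := Hr (x - 1) (lexx _).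
  have hx := hH x.
  case: (pselect (exists2 k, (0 < k)%N & W k (x - 1) = 1)) => Wk.
    rewrite asboolT //.
    have Hlt : H (r (x - 1)) < H (x - 1).
      rewrite lt_neqAle Hx1 andbT; apply/eqP => HE.
      have [k k0 Wk1] := Wk.
      have : W k (x - 1) = 0; last lia.
      apply: (seats_empty (N := (k + absz (x - r (x - 1)%R)%R).+1) (W01 (x - 1))); last lia.
      by rewrite Ws; lia.
    case: (last_record_step (rP (x - 1))) => [] [Hx /last_record_unique/(_ (rP x)) <-].
      by case: (e01 x) hx; lia.
    by case: (e01 x) hx; lia.
  rewrite asboolF //.
  have HE : H (x - 1) = H (r (x - 1)).
    have := Ws `|(x - r (x - 1)%R)%R|.+1 ltac:(lia).
    rewrite big_nat_cond big1; first lia.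
    move=> j /andP[jN _]; case: (W01 (x - 1) j ltac:(lia)) => // Wj1.
    by case: Wk; exists j => //; lia.
  case: (last_record_step (rP (x - 1))) => [] [Hx /last_record_unique/(_ (rP x)) <-].
    by case: (e01 x) hx; lia.
  by case: (e01 x) hx; lia.
have comp x : complementary W V x.
  have [rx _ _] := rP x; move: x rx.
  suff key y : r y <= y -> forall x, r y <= x -> complementary W V x.
    by move=> x rx; apply: (key x).
  move=> _; apply: int_ind_ge => [|x _ /step[]//] i j ij.
  have [W0 _ _] := carrier_count e01 hH WP (rP y).
  by rewrite W0; lia.
by split=> // k x k0; have [_ ->] := step x (comp (x - 1)).
Qed.

(** * Slots *)

Lemma s_oo0P {eta H : int -> int} : binary eta -> height eta H -> escapes H ->
  is_record eta (s_oo0 eta) /\ s_oo0 eta <= 0.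
Proof.
move=> e01 hH esc; have [r [r0 Hr rl]] := last_record_exists _ _ 0 e01 hH esc.
set P := [set x : int | [/\ is_record eta x, x <= 0 &
    forall y : int, is_record eta y -> y <= 0 -> y <= x]]%classic.
suff [? ? _] : P (s_oo0 eta) by split.
apply: xgetPex; exists r; split=> //; first by apply/(is_recordP hH).
move=> y /(is_recordP hH) yrec y0; have [//|ry] := leP y r.
by have := yrec r ry; have := Hr y y0; lia.
Qed.

Lemma xiP (eta : int -> int) (k : nat) : is_xi eta k (xi eta k).
Proof.
rewrite /xi; apply: (xgetPex _ (P := [set f | is_xi eta k f]%classic)).
have [f [f0 fP]] := primitive_exists
  (fun x => 1 - \sum_(1 <= j < k.+1) (eta_up eta j x + eta_down eta j x)) (s_oo0 eta) 0.
by exists f.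
Qed.

Section Slots.
Variables (eta H : int -> int) (k : nat).
Hypotheses (e01 : binary eta) (hH : height eta H) (esc : escapes H).

Let WP : is_carrier eta (carrier eta) := carrierP e01 hH esc.
Let W01 x : seats01 (carrier eta) x.
Proof. by move=> j j0; have [b _ _] := WP j j0. Qed.

Lemma xi_step (x : int) :
  xi eta k x = xi eta k (x - 1) \/ xi eta k x = xi eta k (x - 1) + 1.
Proof.
have [_ /(_ x)] := xiP eta k; have := slot_step01 _ _ k x e01 (W01 (x - 1)).
by rewrite /eta_up /eta_down; lia.
Qed.

Lemma xi_le (x y : int) : x <= y -> xi eta k x <= xi eta k y.
Proof.
move: y; apply: int_ind_ge => // y _ IH.
by case: (xi_step y); lia.
Qed.

(** A record is a hole met by an empty carrier, so no seat changes there. *)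
Lemma xi_record (r : int) : is_record eta r -> xi eta k r = xi eta k (r - 1) + 1.
Proof.
move=> /(is_recordP hH) rrec; have [r' lr] := last_record_exists _ _ (r - 1) e01 hH esc.
have [_ _ Ws] := carrier_count e01 hH WP lr; have [r'r Hr' _] := lr.
have Hrr' := rrec r' ltac:(lia); have Hr1 := Hr' (r - 1) (lexx _).
have er : eta r = 0 by have := hH r; case: (e01 r); lia.
have [_ /(_ r)] := xiP eta k; rewrite big_nat_cond big1; first lia.
move=> j /andP[jk _]; rewrite /eta_up /eta_down /seat_up /seat_down er.
rewrite (seats_empty (N := (j + absz (r - r')%R).+1) (W01 (r - 1))); first ring.
  by rewrite Ws; have := hH r; lia.
lia.
Qed.

Lemma xi_unbounded (v : int) : exists x, xi eta k x <= v.
Proof.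
suff key n : exists x, xi eta k x <= xi eta k 0 - n%:Z.
  by have [x xv] := key (absz (xi eta k 0 - v)%R); exists x; lia.
elim: n => [|n [x xn]]; first by exists 0; lia.
have [r lr] := last_record_exists _ _ x e01 hH esc; have [rx _ _] := lr.
exists (r - 1); have := xi_record _ (last_record_is_record hH lr).
by have := xi_le _ _ rx; lia.
Qed.

(** [xi] is nondecreasing, starts from arbitrarily low values and rises by at most one per site, so
    it cannot skip a level. *)
Lemma s_spec (i : int) :
  (exists a, [/\ s eta k i = a%:E, xi eta k a = i & forall y, y < a -> xi eta k y < i])
  \/ (s eta k i = +oo%E /\ forall y, xi eta k y < i).
Proof.
rewrite /s; case: xgetP => [_ -> [m [xim mmin] <-]|none].
  left; exists m; split=> // y ym; have := xi_le y m (ltW ym); rewrite xim.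
  by case: ltgtP => // /mmin; lia.
right; split=> // y; have [//|iy] := ltP (xi eta k y) i.
have [x0 x0i] := xi_unbounded (i - 1).
have [m [im mmin]] : exists m, i <= xi eta k m /\ forall x, i <= xi eta k x -> m <= x.
  apply: (int_min _ x0); last by exists y.
  by move=> x ix; have [//|/ltW/xi_le] := leP x0 x; lia.
have xm : xi eta k (m - 1) < i.
  by have [//|/mmin] := ltP (xi eta k (m - 1)) i; lia.
case: (none m%:E); exists m => //; split; first by case: (xi_step m); lia.
by move=> x xi_x; apply: mmin; lia.
Qed.

Lemma s_seats_eq {i a : int} : (0 < k)%N -> xi eta k a = i ->
  (forall y, y < a -> xi eta k y < i) -> carrier eta k a = carrier eta k.+1 a.
Proof.
move=> k0 xa ya; apply: slot_seats_eq => //.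
  by move=> j j0; have [_ _ ->] := WP j j0.
by have [_ /(_ a)] := xiP eta k; rewrite /eta_up /eta_down; have := ya (a - 1); lia.
Qed.

End Slots.

(** * Sums between slots, and the shift from the slots of [eta] to those of [T eta] *)

(** Covers both a finite upper slot, [t = b], and [t = +oo] with terms that vanish beyond [b]: the
    partial sums are eventually constant. *)
Lemma sum_primitive (R : realType) (t : \bar int) (g f : int -> int) (a b : int) :
  primitive g f -> a <= b -> (forall y, a < y -> y <= b -> (y%:E <= t)%E) ->
  (forall y, b < y -> (y%:E <= t)%E -> g y = 0) ->
  (\sum_(0 <= n <oo | (a + n.+1%:Z)%:E <= t) ((g (a + n.+1%:Z))%:~R : R)%:E)%E =
  ((f b - f a)%:~R)%:E.
Proof.
move=> fP ab le_t g0.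
have partial M : (\sum_(0 <= n < M | (a + n.+1%:Z)%:E <= t)
    ((g (a + n.+1%:Z))%:~R : R)%:E)%E = ((f (Num.min (a + M%:Z) b) - f a)%:~R)%:E.
  elim: M => [|M IH].
    by rewrite big_geq // addr0 min_l // subrr.
  rewrite big_mkcond big_nat_recr // -big_mkcond IH /=.
  have [Mb|bM] := leP (a + M.+1%:Z) b.
    rewrite le_t //; last lia.
    rewrite min_l; last lia.
    rewrite -EFinD -rmorphD /=; congr ((_ %:~R)%:E).
    have := fP (a + M.+1%:Z); have -> : a + M.+1%:Z - 1 = a + M%:Z by lia.
    lia.
  rewrite min_r; last lia.
  by case: ifP => [/(g0 _ bM) ->|_]; rewrite adde0.
apply: lim_near_cst => //; exists `|b - a|%N => // M /= baM.
by rewrite partial min_r //; lia.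
Qed.

Lemma complementary_sum_le (W V : nat -> int -> int) (k : nat) (x : int) :
  seats01 W x -> seats01 V x -> complementary W V x ->
  \sum_(1 <= j < k.+1) (W j x + V j x) <= k%:Z.
Proof.
move=> W01 V01 comp; elim: k => [|k IH]; first by rewrite big_geq.
rewrite big_nat_recr //=.
suff WV : W k.+1 x + V k.+1 x <= 1 by apply: le_trans (lerD IH WV) _; lia.
have := comp k.+1 k.+1 ltac:(lia).
by case: (W01 k.+1 isT) => ->; case: (V01 k.+1 isT) => ->; lia.
Qed.

Lemma complementary_sum_eq (W V : nat -> int -> int) (k m : nat) (x : int) :
  complementary W V x -> (0 < k <= m)%N -> W m x = 1 ->
  \sum_(1 <= j < k.+1) (W j x + V j x) = k%:Z.
Proof.
move=> comp km Wm; rewrite (eq_big_nat _ _ (F2 := fun=> 1)).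
  by rewrite sumr_const_nat subn1; lia.
by move=> j jk; have := comp j m ltac:(lia) Wm; lia.
Qed.

(** Let [E] have increments [down]. Eliminating [up] and [down'] through the carrier recursions,
    [xi eta k] is [y - w y - 2 * E y] and [xi (T eta) k] is [y + v y - 2 * E y], up to constants.
    These are fixed at the two records [s_oo0], where [w] and [v] vanish, and they combine to
    [offset]. *)
Lemma xi_T (eta H H' : int -> int) (k : nat) (x : int) :
  binary eta -> height eta H -> escapes H ->
  binary (T eta) -> height (T eta) H' -> escapes H' ->
  (forall j x, (0 < j)%N -> eta_up (T eta) j x = eta_down eta j x) ->
  xi (T eta) k x = xi eta k x +
    \sum_(1 <= j < k.+1) (carrier eta j x + carrier (T eta) j x) + offset eta k.
Proof.
move=> e01 hH esc e01' hH' esc' up_down.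
have WP := carrierP e01 hH esc; have VP := carrierP e01' hH' esc'.
pose w y := \sum_(1 <= j < k.+1) carrier eta j y.
pose v y := \sum_(1 <= j < k.+1) carrier (T eta) j y.
pose up y := \sum_(1 <= j < k.+1) eta_up eta j y.
pose down y := \sum_(1 <= j < k.+1) eta_down eta j y.
pose down' y := \sum_(1 <= j < k.+1) eta_down (T eta) j y.
have up'E y : \sum_(1 <= j < k.+1) eta_up (T eta) j y = down y.
  by apply: eq_big_nat => j jk; rewrite up_down //; lia.
have stepW y : w y = w (y - 1) + up y - down y.
  rewrite /w /up /down -big_split -sumrB; apply: eq_big_nat => j jk.
  by have [_ _ ->] := WP j ltac:(lia).
have stepV y : v y = v (y - 1) + down y - down' y.
  rewrite -up'E /v /down' -big_split -sumrB; apply: eq_big_nat => j jk.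
  by have [_ _ ->] := VP j ltac:(lia).
have [[rec0 s0] [rec0' s0']] := (s_oo0P e01 hH esc, s_oo0P e01' hH' esc').
have w0 : w (s_oo0 eta) = 0.
  by rewrite /w big_nat_cond big1 // => j /andP[jk _]; have [_ ->] := WP j ltac:(lia).
have v0 : v (s_oo0 (T eta)) = 0.
  by rewrite /v big_nat_cond big1 // => j /andP[jk _]; have [_ ->] := VP j ltac:(lia).
have [E [_ EP]] := primitive_exists down 0 0.
have [[xi0 xiS] [xi0' xiS']] := (xiP eta k, xiP (T eta) k).
have hxi : primitive (fun y => 1 - \sum_(1 <= j < k.+1) (eta_up eta j y + eta_down eta j y))
    (fun y => y - w y - 2 * E y).
  move=> y; rewrite big_split -/(up y) -/(down y) /=.
  by have := EP y; have := stepW y; lia.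
have hxi' : primitive
    (fun y => 1 - \sum_(1 <= j < k.+1) (eta_up (T eta) j y + eta_down (T eta) j y))
    (fun y => y + v y - 2 * E y).
  move=> y; rewrite big_split up'E -/(down' y) /=.
  by have := EP y; have := stepV y; lia.
have := primitive_diff (s_oo0 eta) xiS hxi x.
have := primitive_diff (s_oo0 (T eta)) xiS' hxi' x.
rewrite /offset (primitive_sum _ _ _ _ EP); last lia.
have EP' : primitive (fun y => \sum_(1 <= j < k.+1) eta_up (T eta) j y) E.
  by move=> y; rewrite up'E; exact: EP.
rewrite (primitive_sum _ _ _ _ EP') ?addrK; last lia.
rewrite big_split -/(w x) -/(v x) xi0 xi0' w0 v0 /=; lia.
Qed.

Theorem theorem4p5 (R : realType) (eta : int -> int) (heta : Omega R eta)
    (k : nat) (hk : (0 < k)%N) (i : int) (hs : (s eta k (i + 1)%R < +oo)%E) :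
  zeta R (T eta) k (i + k%:Z + offset eta k) = zeta R eta k i.
Proof.
have [e01 _] := heta.
have [H [_ hH]] := primitive_exists (fun y => 2 * eta y - 1) 0 0.
have esc : escapes H.
  move=> B; have [N HN] := Omega_escapes heta hH (fun x => lexx x) B.
  by exists N => z /HN; lia.
have /choice[r rP] : forall x, exists r, last_record H x r.
  by move=> x; apply: last_record_exists.
have hH' := height_T e01 hH esc rP; have e01' := binary_T e01 hH esc.
have esc' := Omega_escapes heta hH (fun x => let: And3 h _ _ := rP x in h).
set H' := (fun x => _) in hH' esc'.
have WP := carrierP e01 hH esc; have VP := carrierP e01' hH' esc'.
have [comp up_down] := complementary_carriers e01 hH esc rP WP VP.
have {}up_down j x : (0 < j)%N -> eta_up (T eta) j x = eta_down eta j x.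
  by move=> j0; apply: up_down.
have W01 x : seats01 (carrier eta) x by move=> j j0; have [b _ _] := WP j j0.
have V01 x : seats01 (carrier (T eta)) x by move=> j j0; have [b _ _] := VP j j0.
have xiE x := xi_T _ _ _ k x e01 hH esc e01' hH' esc' up_down.
set i' := i + k%:Z + offset eta k.
(* By [up_down] this is also the summand of [zeta] for [T eta], so [Psi] evaluates both sides. *)
pose F y := eta_down eta k y - eta_down eta k.+1 y.
have [Psi [_ PsiP]] := primitive_exists F 0 0.
(* A change of seat [k] or [k+1] downwards requires that seats [1..k] of
   [eta] and [T eta] are fully complementary, i.e. that [xi (T eta) k] has
   already reached the shifted level. *)
have F0 (y j : int) : j <= xi eta k (y - 1) -> xi (T eta) k (y - 1) < j + k%:Z + offset eta k ->
    F y = 0.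
  move=> jxi; rewrite xiE => xij.
  have Wn m : (k <= m)%N -> carrier eta m (y - 1) = 0.
    move=> km; case: (W01 (y - 1) m ltac:(lia)) => // Wm.
    have := complementary_sum_eq _ _ k m _ (comp (y - 1)) ltac:(lia) Wm; lia.
  by rewrite /F /eta_down /seat_down !Wn // !mulr0 !mul0r subrr.
have PsiF (c d : int) : c <= d -> (forall y, c < y -> y <= d -> F y = 0) -> Psi d = Psi c.
  move: d; apply: int_ind_ge => // d cd IH Fd.
  rewrite -IH => [|y cy yd]; last by apply: Fd; lia.
  by have := PsiP d; rewrite Fd //; lia.
have le_xi x y := xi_le eta H k e01 hH esc x y.
(* The seat count in [xi_T] is at most [k], so [T eta] cannot reach the shifted level before [eta]
   reaches [j]. *)
have level_le (c d j : int) : (forall y, y < c -> xi eta k y < j) ->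
    xi (T eta) k d = j + k%:Z + offset eta k -> c <= d.
  move=> cj; have [//|/cj dj] := leP c d; rewrite xiE.
  by have := complementary_sum_le _ _ k _ (W01 d) (V01 d) (comp d); lia.
have [b [sb xib yb]] : exists b, [/\ s eta k (i + 1) = b%:E, xi eta k b = i + 1 &
    forall y, y < b -> xi eta k y < i + 1].
  by case: (s_spec eta H k e01 hH esc (i + 1)) => // -[sE]; move: hs; rewrite sE.
have [a [sa xia ya]] : exists a, [/\ s eta k i = a%:E, xi eta k a = i &
    forall y, y < a -> xi eta k y < i].
  by case: (s_spec eta H k e01 hH esc i) => // -[_ /(_ b)]; lia.
have ab : a <= b by have [//|/ya] := leP a b; lia.
have -> : zeta R eta k i = ((Psi b - Psi a)%:~R)%:E.
  have Wa := s_seats_eq eta H k e01 hH esc hk xia ya.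
  have Wb := s_seats_eq eta H k e01 hH esc hk xib yb.
  (* Passing from [eta_up] to [eta_down] costs the increment of seat [k] minus seat [k+1], whose
     boundary terms vanish by [Wa] and [Wb]. *)
  have fP : primitive (fun y => eta_up eta k y - eta_up eta k.+1 y)
      (fun y => Psi y + carrier eta k y - carrier eta k.+1 y).
    move=> y; have := PsiP y; rewrite /F.
    have [_ _ ->] := WP k hk; have [_ _ ->] := WP k.+1 isT.
    by rewrite -!/(eta_up _ _ _) -!/(eta_down _ _ _); lia.
  rewrite /zeta sa sb (sum_primitive _ _ _ _ _ b fP ab).
  - by congr ((_ %:~R)%:E); lia.
  - by move=> y _; rewrite lee_fin.
  - by move=> y by_; rewrite lee_fin leNgt by_.
have fP : primitive (fun y => eta_up (T eta) k y - eta_up (T eta) k.+1 y) Psi.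
  by move=> y; rewrite !up_down //; exact: PsiP.
case: (s_spec (T eta) H' k e01' hH' esc' i') => [[a' [sa' xia' ya']]|[sa' ya']]; last first.
  (* The left side is 0 by convention, and [F] vanishes on all of the interval from [a] to [b]. *)
  rewrite /zeta sa' (PsiF a b ab) ?subrr // => y ay _; apply: (F0 y i); last exact: ya'.
  by rewrite -xia; apply: le_xi; lia.
have aa' : a <= a' := level_le a a' i ya xia'.
have Psia : Psi a' = Psi a.
  apply: PsiF => // y ay ya'y; apply: (F0 y i); last by apply: ya'; lia.
  by rewrite -xia; apply: le_xi; lia.
rewrite /zeta sa'; have F0b (y : int) : b < y -> xi (T eta) k (y - 1) < i' + 1 -> F y = 0.
  move=> by_ xiy; apply: (F0 y (i + 1)); last by move: xiy; rewrite /i'; lia.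
  by rewrite -xib; apply: le_xi; lia.
case: (s_spec (T eta) H' k e01' hH' esc' (i' + 1)) => [[b' [sb' xib' yb']]|[sb' yb']].
- have bb' : b <= b' by apply: (level_le b b' (i + 1)) => //; rewrite xib' /i'; lia.
  have a'b' : a' <= b' by have [//|/ya'] := leP a' b'; lia.
  have Psib : Psi b' = Psi b.
    by apply: PsiF => // y by_ yb'y; apply: F0b => //; apply: yb'; lia.
  rewrite sb' (sum_primitive _ _ _ _ _ b' fP a'b') ?Psia ?Psib //.
  by move=> y by_; rewrite lee_fin leNgt by_.
(* The sum for [T eta] now runs to infinity with zero terms beyond [b]; the maximum keeps the
   endpoint at or after [a']. *)
- have Psib : Psi (Num.max a' b) = Psi b.
    by apply: PsiF => [|y by_ _]; [lia | apply: F0b].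
  have a'm : a' <= Num.max a' b by lia.
  rewrite sb' (sum_primitive _ _ _ _ _ _ fP a'm) ?Psia ?Psib //.
  + by move=> y _ _; rewrite leey.
  + move=> y my _; rewrite !up_down //; apply: F0b => //; lia.
Qed.
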